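(* Define integers $a_{\mathcal{G}}(n)$, $n\ge0$, by $a_{\mathcal{G}}(0)=1$, $a_{\mathcal{G}}(1)=-1$, $a_{\mathcal{G}}(2)=-1$ and, for $n\ge3$, $$a_{\mathcal{G}}(n)=-\frac12\left(\sum_{k=0}^{n-2}a_{\mathcal{G}}(k)\binom{n-1}{k}2^{n-1-k}+\sum_{k=0}^{n-1}a_{\mathcal{G}}(k)\binom{n}{k}2^{n-k}\right).$$ Then $a_{\mathcal{G}}(2n)=a_{\mathcal{G}}(2n-1)$ for all $n\ge1$. *)

(* Defs.v *)
From mathcomp Require Import all_boot all_order all_algebra.
Set Implicit Arguments.
Unset Strict Implicit.
Unset Printing Implicit Defensive.
Import Order.TTheory GRing.Theory Num.Theory.
Local Open Scope ring_scope.

(* The factor 1/2 is a genuine rational, so the recurrence is an identity in  *)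
(* rat; the two sums are integers.                                            *)
Definition is_aG (a : nat -> int) : Prop :=
  [/\ a 0%N = 1, a 1%N = -1, a 2%N = -1 &
      forall n : nat, (3 <= n)%N ->
        (a n)%:Q = - (1 / 2) *
          (\sum_(0 <= k < n - 1) a k * ('C(n - 1, k))%:Z * 2 ^+ (n - 1 - k)
           + \sum_(0 <= k < n) a k * ('C(n, k))%:Z * 2 ^+ (n - k))%:Q].

Definition aG_next (s : seq int) : int :=
  let n := size s in
  - (\sum_(0 <= k < n - 1) s`_k * ('C(n - 1, k))%:Z * 2 ^+ (n - 1 - k).-1
     + \sum_(0 <= k < n) s`_k * ('C(n, k))%:Z * 2 ^+ (n - k).-1).

Definition aG_seq (n : nat) : seq int :=
  iter n (fun s => rcons s (if s is [::] then 1 else aG_next s)) [::].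

Lemma size_aG_seq n : size (aG_seq n) = n.
Proof. by elim: n => //= n IH; rewrite size_rcons IH. Qed.

Lemma nth_aG_seq n k : (k < n)%N -> (aG_seq n)`_k = (aG_seq k.+1)`_k.
Proof.
elim: n => // n IH; rewrite ltnS leq_eqVlt => /orP[/eqP-> //|lt_kn].
by rewrite {1}/aG_seq iterS -/(aG_seq n) nth_rcons size_aG_seq lt_kn IH.
Qed.

(* is_aG is not vacuous: the recurrence does produce integers.                *)
Lemma is_aG_exists : exists a : nat -> int, is_aG a.
Proof.
exists (fun n => (aG_seq n.+1)`_n); split.
- by [].
- by rewrite /= /aG_next /= !unlock /=.
- by rewrite /= /aG_next /= !unlock /=.
move=> n n_ge3.
have -> : (aG_seq n.+1)`_n = aG_next (aG_seq n).
  rewrite /aG_seq iterS -/(aG_seq n) nth_rcons size_aG_seq ltnn eqxx.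
  by case: (aG_seq n) (size_aG_seq n) => // n0; rewrite -n0 in n_ge3.
rewrite /aG_next size_aG_seq.
set S := (X in - X); set T := (X in _ * X%:Q).
suff -> : T = 2 * S.
  by rewrite intrM rmorphN /= mulNr mulrA mul1r mulVf ?mul1r.
rewrite /T /S mulrDr !mulr_sumr; congr (_ + _);
  apply: eq_big_nat => k /andP[_ lt_k].
  have lt_kn : (k < n)%N by apply: leq_trans lt_k (leq_subr _ _).
  rewrite nth_aG_seq // -[in LHS](prednK (n := n - 1 - k)) ?subn_gt0 //.
  by rewrite exprS mulrCA.
rewrite nth_aG_seq // -[in LHS](prednK (n := n - k)) ?subn_gt0 //.
by rewrite exprS mulrCA.
Qed.

Lemma is_aG_unique (a b : nat -> int) : is_aG a -> is_aG b -> a =1 b.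
Proof.
move=> [a0 a1 a2 aS] [b0 b1 b2 bS] n.
have [m] := ubnP n; elim: m n => // m IH [|[|[|n]]] lt_nm; rewrite ?a0 ?a1 ?a2 //.
apply: (@intr_inj rat); rewrite aS // bS //; congr (_ * _%:Q); congr (_ + _);
  apply: eq_big_nat => k /andP[_ lt_k]; rewrite IH //.
  by rewrite (leq_trans lt_k) // subn1 /= ltnW.
exact: leq_trans lt_k lt_nm.
Qed.

(* Main.v *)
Require Import Defs.
From HB Require Import structures.
From mathcomp Require Import all_boot all_order all_algebra.
From mathcomp Require Import ring zify.
Import Order.TTheory GRing.Theory Num.Theory.
Local Open Scope ring_scope.

(** Let [L] be the linear functional on polynomials with [L (x^n) = a n].  In
    the variable [y = x + 1] the recurrence reads
    [L ((y - 1)^n (y - 2) + (y + 1)^n (y + 2)) = 0].  With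
    [u_n = (y + 1)^n (y + 2)] the first summand is [- (-1)^n u_n(-y)], so [L]
    kills the odd part of [u_n] for [n] even and the even part for [n] odd.
    As [u_(2m)] is monic of degree [2m + 1], the first fact gives by induction
    that [L] kills every odd polynomial in [y]; hence [L (u_n) = 0] for [n] odd,
    which is the claim. *)

Set Implicit Arguments.
Unset Strict Implicit.
Unset Printing Implicit Defensive.

Section UmbralFunctional.
Variables (R : comNzRingType) (a : nat -> R).

Definition umbral (p : {poly R}) : R := \sum_(i < size p) p`_i * a i.

(** Padding with zero coefficients to a common bound lets polynomials of different sizes be compared
    termwise in the proof of linearity. *)
Lemma umbral_wide n (p : {poly R}) :
  (size p <= n)%N -> umbral p = \sum_(i < n) p`_i * a i.
Proof.
move=> le_pn; rewrite /umbral (big_ord_widen n (fun i => p`_i * a i)) //.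
rewrite big_mkcond /=; apply: eq_bigr => i _.
by case: ltnP => // le_pi; rewrite nth_default // mul0r.
Qed.

Lemma umbral_is_linear : scalar umbral.
Proof.
move=> c p q; pose n := maxn (size p) (size q).
have le_pn : (size p <= n)%N by apply: leq_maxl.
have le_qn : (size q <= n)%N by apply: leq_maxr.
have le_n : (size (c *: p + q)%R <= n)%N.
  by rewrite (leq_trans (size_polyD _ _)) // geq_max le_qn
             (leq_trans (size_scale_leq _ _)).
rewrite !(@umbral_wide n) // mulr_sumr -big_split; apply: eq_bigr => i _ /=.
by rewrite coefD coefZ mulrDl mulrA.
Qed.

HB.instance Definition _ :=
  GRing.isLinear.Build R {poly R} R *%R umbral umbral_is_linear.

Lemma umbralXn n : umbral 'X^n = a n.
Proof.
rewrite /umbral size_polyXn big_ord_recr /= coefXn eqxx mul1r big1 ?add0r //.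
by move=> i _; rewrite coefXn ltn_eqF ?mul0r.
Qed.

Lemma umbral_XaddC_exp (c : R) n :
  umbral (('X + c%:P) ^+ n) =
    \sum_(0 <= k < n.+1) a k * 'C(n, k)%:R * c ^+ (n - k).
Proof.
rewrite addrC exprDn big_mkord raddf_sum; apply: eq_bigr => i _ /=.
rewrite -polyC_exp mul_polyC raddfMn /= linearZ /= umbralXn.
by rewrite -[in LHS]mulr_natr; ring.
Qed.

End UmbralFunctional.

(** The argument of [g] is twice the odd part of [q]. The bound [i < size q] makes the lemma usable
    inside an induction on the degree. *)
Lemma scalar_odd_part_eq0 (R : comNzRingType) (g : {scalar {poly R}})
    (q : {poly R}) :
  (forall i, odd i -> (i < size q)%N -> g 'X^i = 0) ->
  g (q - (q \Po - 'X)) = 0.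
Proof.
move=> g_odd.
have {1}-> : q = \sum_(i < size q) q`_i *: 'X^i by rewrite -poly_def coefK.
rewrite comp_polyE -sumrB raddf_sum big1 //.
move=> i _ /=; rewrite -scalerBr linearZ /= exprNn -signr_odd.
case: (boolP (odd i)) => [odd_i|_]; last first.
  by rewrite expr0 mul1r subrr raddf0 mulr0.
by rewrite expr1 mulN1r opprK raddfD /= g_odd // addr0 mulr0.
Qed.

Lemma umbral_aG_rec (a : nat -> int) n : is_aG a ->
  umbral a ('X^n * ('X - 1) + ('X + 2%:P) ^+ n * ('X + 3%:P)) = 0.
Proof.
move=> [a0 a1 a2 aS].
have -> : 'X^n * ('X - 1) + ('X + 2%:P) ^+ n * ('X + 3%:P) =
    'X^(n.+1) - 'X^n + ('X + 2%:P) ^+ n.+1 + ('X + 2%:P) ^+ n :> {poly int}.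
  by rewrite !exprS (_ : 3%:P = 2%:P + 1) ?polyCD //; ring.
have shiftE m : umbral a (('X + 2%:P) ^+ m) =
    \sum_(0 <= k < m) a k * 'C(m, k)%:Z * 2 ^+ (m - k) + a m.
  rewrite umbral_XaddC_exp big_nat_recr //= subnn binn expr0 !mulr1.
  by congr (_ + _); apply: eq_bigr => k _; rewrite (natz 'C(m, k)).
rewrite !(raddfD (umbral a)) raddfN /= !umbralXn !shiftE.
(* The recurrence at index [n.+1] applies only from [n = 2] on; the first two cases come from the
   initial values. *)
case: n => [|[|n]].
- by rewrite !unlock /= a0 a1.
- by rewrite !unlock /= a0 a1 a2.
have := aS n.+3 isT; rewrite subn1 /=.
set S := \sum_(0 <= k < n.+2) _; set T := \sum_(0 <= k < n.+3) _ => rec.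
have rec2 : 2 * a n.+3 = - (S + T).
  by apply: (@intr_inj rat); rewrite intrM rec rmorphN /=; field.
by rewrite -/S -/T; lia.
Qed.

Section ShiftedFunctional.
Variables (a : nat -> int) (ha : is_aG a).

(** Composing with ['X + 1] makes the indeterminate in the argument of [g] stand for y = x + 1. *)
Let g : {scalar {poly int}} := umbral a \o comp_poly ('X + 1).
Let u n : {poly int} := ('X + 1) ^+ n * ('X + 2%:P).

Let gD p q : g (p + q) = g p + g q. Proof. exact: raddfD. Qed.
Let gB p q : g (p - q) = g p - g q. Proof. exact: raddfB. Qed.

Lemma shifted_rec n : g (u n - (-1) ^+ n *: (u n \Po - 'X)) = 0.
Proof.
rewrite -[RHS](umbral_aG_rec n ha) /= /u; congr umbral.
rewrite comp_polyB comp_polyZ -comp_polyA !comp_polyM !rmorphXn /=.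
rewrite !comp_polyD !comp_polyX !rmorph1 !comp_polyC.
rewrite (raddfN (comp_poly ('X + 1))) /= comp_polyX.
have -> : - ('X + 1) + 1 = - 'X :> {poly int} by ring.
rewrite -mul_polyC rmorphXn rmorphN /= polyC1 [(- 'X) ^+ n]exprNn.
(* One sign comes from the statement, the other from [(- 'X) ^+ n]. *)
have sgn2 : (-1) ^+ n * (-1) ^+ n = 1 :> {poly int}.
  by rewrite -exprMn mulN1r opprK expr1n.
have -> : 3%:P = 2%:P + 1 :> {poly int} by rewrite -polyC1 -polyCD.
have -> : 2%:P = 1 + 1 :> {poly int} by rewrite -polyC1 -polyCD.
rewrite -addrA (mulrA ((-1) ^+ n)) (mulrA ((-1) ^+ n) _ 'X^n) sgn2 mul1r.
by ring.
Qed.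

Lemma shifted_Xodd m : g 'X^(m.*2.+1) = 0.
Proof.
have [k] := ubnP m; elim: k m => // k IH m; rewrite ltnS => le_mk.
have mon_u : u m.*2 \is monic.
  by rewrite rpredM ?rpredX // -1?polyC1 monicXaddC.
have size_u : size (u m.*2) = m.*2.+2.
  have -> : u m.*2 = ('X - (-1)%:P) ^+ m.*2 * ('X + 2%:P).
    by rewrite /u rmorphN opprK.
  by rewrite size_monicM ?monic_exp ?monicXsubC ?monic_neq0 ?monicXaddC //
             size_exp_XsubC size_XaddC addn2.
(* Without its leading term, [u m.*2] has degree at most 2m, so the odd powers left in it fall under
   the induction hypothesis. *)
pose v := u m.*2 - 'X^(m.*2.+1).
have size_v : (size v <= m.*2.+1)%N.
  apply/leq_sizeP => j; rewrite leq_eqVlt coefB coefXn => /predU1P[<-|lt_j].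
    by rewrite eqxx; move/monicP: mon_u; rewrite lead_coefE size_u => ->.
  by rewrite gtn_eqF // nth_default ?subrr // size_u.
have v0 : g (v - (v \Po - 'X)) = 0.
  apply: scalar_odd_part_eq0 => i odd_i lt_i.
  rewrite -(odd_double_half i) odd_i add1n IH //.
  have := leq_trans lt_i size_v.
  rewrite -[X in (X < _)%N]odd_double_half odd_i add1n ltnS ltn_double => lt_hm.
  exact: leq_trans lt_hm le_mk.
(* Since [v] contributes nothing, the recurrence at an even index leaves twice the value of [g] at
   the leading power. *)
have := shifted_rec m.*2; rewrite -signr_odd odd_double expr0 scale1r.
have -> : u m.*2 = v + 'X^(m.*2.+1) by rewrite subrK.
rewrite comp_polyD opprD addrACA gD v0 add0r comp_Xn_poly.
rewrite exprNn -signr_odd oddS odd_double expr1 mulN1r opprK gD.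
by rewrite -mulr2n => /eqP; rewrite mulrn_eq0 => /eqP.
Qed.

(** For odd [n] the recurrence kills twice the even part of [u n], and [shifted_Xodd] kills the odd
    part; 2 is cancelled in [int]. *)
Lemma shifted_odd_eq0 n : odd n -> g (u n) = 0.
Proof.
move=> odd_n; have := shifted_rec n.
rewrite -signr_odd odd_n expr1 scaleN1r opprK gD => even0.
have : g (u n - (u n \Po - 'X)) = 0.
  apply: scalar_odd_part_eq0 => i odd_i _.
  by rewrite -(odd_double_half i) odd_i shifted_Xodd.
rewrite gB => /subr0_eq odd0; move: even0.
by rewrite -odd0 -mulr2n => /eqP; rewrite mulrn_eq0 => /eqP.
Qed.

Lemma aG_succ_odd n : odd n -> a n.+1 = a n.
Proof.
move=> odd_n; have := umbral_aG_rec n ha.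
have -> : ('X + 2%:P) ^+ n * ('X + 3%:P) = u n \Po ('X + 1).
  rewrite /u comp_polyM rmorphXn /= !comp_polyD !comp_polyX rmorph1 comp_polyC.
  by rewrite -!addrA -polyC1 -!polyCD.
(* The second summand vanishes, leaving the functional at ['X^n * ('X - 1)], which is
   [a n.+1 - a n]. *)
rewrite raddfD [X in _ + X](shifted_odd_eq0 odd_n) addr0.
by rewrite mulrBr mulr1 -exprSr raddfB /= !umbralXn => /subr0_eq.
Qed.

End ShiftedFunctional.

Theorem mainTheorem17 (a : nat -> int) (ha : is_aG a) (n : nat) (hn : (1 <= n)%N) :
  a (2 * n)%N = a (2 * n - 1)%N.
Proof.
case: n hn => // n _; rewrite mul2n doubleS subn1 /=.
by apply: aG_succ_odd; rewrite //= odd_double.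
Qed.
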